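(* Let $\mathcal{D}=(\Delta_0\times\Delta_1,\mathcal{B})$ be the design constructed from $\mathcal{D}_0,\mathcal{D}_1,\mathcal{D}_2,(\psi_\beta)_{\beta\in\mathcal{L}_1}$ as described in the context, let $G=\mathrm{Aut}(\mathcal{D})\cap(\mathrm{Sym}(\Delta_0)\wr\mathrm{Sym}(\Delta_1))$, and let $g=(h_1,\dots,h_{v_1})\sigma\in G$. Then the following hold. 1. $\sigma\in\mathrm{Aut}(\mathcal{D}_1)$, and, for each $j\in\Delta_1$, $h_j$ lies in the subgroup $\mathrm{Aut}^*(\mathcal{D}_0)$ of $\mathrm{Aut}(\mathcal{D}_0)$ preserving the set $\mathcal{P}_0$ of parallel classes. 2. Both of the following properties hold for $g$: (i) for all $\beta\in\mathcal{L}_1$ and all $j\in\beta$, $(\psi_\beta^{-1}(j))^{h_j}=\psi_{\beta^\sigma}^{-1}(j^\sigma)$; (ii) for all $\beta\in\mathcal{L}_1$ and all $\gamma\in\mathcal{L}_2$, the set $$\gamma'_{\gamma,\beta,g}:=\{(\gamma\cap\psi_\beta^{-1}(j))^{h_j}\mid j\in\beta\text{ such that }\gamma\cap\psi_\beta^{-1}(j)\neq\emptyset\}$$ belongs to $\mathcal{L}_2$, and moreover $\gamma'_{\gamma,\beta,g}\cap\psi_{\beta^\sigma}^{-1}(j^\sigma)=(\gamma\cap\psi_\beta^{-1}(j))^{h_j}$ for all $j\in\beta$. 3. For each $\beta\in\mathcal{L}_1$ and $\gamma\in\mathcal{L}_2$, $B_\beta(\gamma)^g=B_{\beta^\sigma}(\gamma'_{\gamma,\beta,g})$,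 and in particular $G$ leaves invariant the partition $\{\mathcal{B}_\beta\mid\beta\in\mathcal{L}_1\}$ of $\mathcal{B}$. 4. If $\sigma=1$ then, for each $j\in\Delta_1$, $h_j$ lies in the subgroup $T_0$ of $\mathrm{Aut}(\mathcal{D}_0)$ fixing setwise each of the parallel classes in $\mathcal{P}_0$.
   Context: Input data: 1. $\mathcal{D}_0=(\Delta_0,\mathcal{L}_0)$ is a resolvable $2$-$(v_0,k_0,\lambda_0)$ design: its block set $\mathcal{L}_0$ is partitioned into a set $\mathcal{P}_0=\{P_1,\dots,P_r\}$ of $r$ parallel classes, each $P_i$ consisting of $s$ blocks that partition the point set $\Delta_0$. So $v_0=sk_0$ and $(v_0-1)\lambda_0=r(k_0-1)$. 2. $\mathcal{D}_1=(\Delta_1,\mathcal{L}_1)$ is a symmetric $2$-$(v_1,r,\lambda_1)$ design (blocks of size $r$; degenerate cases such as the $2$-$(v_1,v_1-1,v_1-2)$ design are allowed), so $(v_1-1)\lambda_1=r(r-1)$; its points are labelled $1,\dots,v_1$; together with bijections $\psi_\beta:\mathcal{P}_0\to\beta$ for $\beta\in\mathcal{L}_1$, such that for each $P\in\mathcal{P}_0$ and $i\in\Delta_1$ there is a unique $\beta\in\mathcal{L}_1$ with $\psi_\beta(P)=i$. 3. $\mathcal{D}_2=(\Delta_2,\mathcal{L}_2)$ is a transversal design: its point set is $\Delta_2=\bigcup_{P\in\mathcal{P}_0}P$ $(=\mathcal{L}_0)$, partitioned into $r$ ''groups'' of size $s$, namely the parallel classes $P\in\mathcal{P}_0$; each block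 has size $k_2\le r$ and meets each group in at most one point; and any two points in different groups lie in exactly $\lambda_2$ blocks. There are $b_2$ blocks and each point lies in $r_2$ blocks, where $r_2=\frac{(r-1)s\lambda_2}{k_2-1}$ and $b_2=\frac{r(r-1)s^2\lambda_2}{k_2(k_2-1)}$. Construction: for $\gamma\in\mathcal{L}_2$, $\beta\in\mathcal{L}_1$ and $j\in\beta$, the intersection $\gamma\cap\psi_\beta^{-1}(j)$ is either empty or a single block of the parallel class $\psi_\beta^{-1}(j)$; in the latter case it is identified with that block, regarded (as appropriate) as an element of $\Delta_2=\mathcal{L}_0$ or as a subset of $\Delta_0$. Put $$B_\beta(\gamma):=\bigcup_{j\in\beta}\big((\gamma\cap\psi_\beta^{-1}(j))\times\{j\}\big)\subseteq\Delta_0\times\Delta_1 .$$ The design $\mathcal{D}=(\Delta_0\times\Delta_1,\mathcal{B})$ has point set $\Delta_0\times\Delta_1$ and block set $\mathcal{B}$ equal to the disjoint union over $\beta\in\mathcal{L}_1$ of the sets $\mathcal{B}_\beta=\{B_\beta(\gamma)\mid\gamma\in\mathcal{L}_2\}$. Automorphisms: an automorphism of a design is a permutation of its points leaving its block set invariant. Permutations act on the right, written exponentially. $G$ is the group of all automorphisms of $\mathcal{D}$ leaving invariant the partition $\{\Delta_0\times\{i\}\mid i\in\Delta_1\}$ of the point set; a typical element of $\mathrm{Sym}(\Delta_0)\wr\mathrm{Sym}(\Delta_1)$ is $g=(h_1,\dots,h_{v_1})\sigma$ with $h_i\in\mathrm{Sym}(\Delta_0)$, $\sigma\in\mathrm{Sym}(\Delta_1)$,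 acting by $(\delta,j)^g=(\delta^{h_j},j^\sigma)$. For $\beta\subseteq\Delta_1$, $\beta^\sigma=\{j^\sigma\mid j\in\beta\}$; for a parallel class $P$, $P^{h}=\{\ell^{h}\mid\ell\in P\}$. *)

(* Defs.v *)
From HB Require Import structures.
From mathcomp Require Import all_boot all_fingroup.

Set Implicit Arguments.
Unset Strict Implicit.
Unset Printing Implicit Defensive.

(* Designs are simple: the block set is a [{set {set T}}].  For permutations,
   [g x] is the image x^g of the right action, and [g @: A] is A^g. *)

Record two_design (T : finType) (L : {set {set T}}) (v k lambda : nat) : Prop :=
  TwoDesign {
    two_design_points : #|T| = v;
    two_design_blocks : forall b, b \in L -> #|b| = k;
    two_design_pairs : forall x y : T, x != y ->
      #|[set b in L | (x \in b) && (y \in b)]| = lambda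
  }.

Record resolvable_design (T : finType) (L : {set {set T}})
    (classes : {set {set {set T}}}) (v k lambda r s : nat) : Prop :=
  ResolvableDesign {
    resolvable_two_design : two_design L v k lambda;
    resolvable_partition : partition classes L;
    resolvable_card : #|classes| = r;
    resolvable_class_card : forall P, P \in classes -> #|P| = s;
    resolvable_parallel : forall P, P \in classes -> partition P [set: T]
  }.

Record symmetric_design (T : finType) (L : {set {set T}}) (v k lambda : nat)
    : Prop :=
  SymmetricDesign {
    symmetric_two_design : two_design L v k lambda;
    symmetric_card : #|L| = v
  }.

(* The point set is a subset [X] of the ambient type.  The conditions [1 < k]
   and [0 < lambda] make the replication number (r-1)s lambda/(k-1) defined and
   positive; its value and the number of blocks then follow by counting. *)
Record transversal_design (T : finType) (X : {set T}) (groups : {set {set T}})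
    (L : {set {set T}}) (r s k lambda : nat) : Prop :=
  TransversalDesign {
    transversal_partition : partition groups X;
    transversal_card : #|groups| = r;
    transversal_group_card : forall P, P \in groups -> #|P| = s;
    transversal_k_gt1 : 1 < k;
    transversal_k_le : k <= r;
    transversal_lambda_gt0 : 0 < lambda;
    transversal_block_sub : forall c, c \in L -> c \subset X;
    transversal_block_card : forall c, c \in L -> #|c| = k;
    transversal_meet : forall c P, c \in L -> P \in groups -> #|c :&: P| <= 1;
    transversal_pairs : forall P Q x y,
      P \in groups -> Q \in groups -> P != Q -> x \in P -> y \in Q ->
      #|[set c in L | (x \in c) && (y \in c)]| = lambda
  }.

Definition design_aut (T : finType) (L : {set {set T}}) : {set {perm T}} :=
  'N(L | 'P^*)%g.

Section Construction.

Variables (D0 D1 : finType).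
Implicit Types (b : {set D1}) (c : {set {set D0}}) (j : D1).

Definition aut_star (L0 : {set {set D0}}) (P0 : {set {set {set D0}}})
    : {set {perm D0}} :=
  (design_aut L0 :&: 'N(P0 | ('P^*)^*))%g.

(* [T_0]: the pointwise stabiliser of the set of parallel classes. *)
Definition aut_classes (L0 : {set {set D0}}) (P0 : {set {set {set D0}}})
    : {set {perm D0}} :=
  (design_aut L0 :&: 'C(P0 | ('P^*)^*))%g.

(* Only the values [psi b P] with [b] in [L1] and [P] in [P0] matter. *)
Record bijection_family (P0 : {set {set {set D0}}}) (L1 : {set {set D1}})
    (psi : {set D1} -> {set {set D0}} -> D1) : Prop :=
  BijectionFamily {
    bijection_inj : forall b, b \in L1 -> {in P0 &, injective (psi b)};
    bijection_im : forall b, b \in L1 -> psi b @: P0 = b;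
    bijection_uniq : forall P j, P \in P0 ->
      exists! b : {set D1}, b \in L1 /\ psi b P = j
  }.

Variables (P0 : {set {set {set D0}}})
          (psi : {set D1} -> {set {set D0}} -> D1).

(* [psi_b^-1(j)]; the default value [set0] is used only when [j] is not in
   [b]. *)
Definition psi_inv b j : {set {set D0}} :=
  odflt set0 [pick P in P0 | psi b P == j].

Definition trace c b j : {set {set D0}} := c :&: psi_inv b j.

(* [trace c b j] is empty or a singleton [{l}]; as a subset of [D0] it is its
   union [cover], namely the empty set or [l]. *)
Definition block_of b c : {set D0 * D1} :=
  \bigcup_(j in b) setX (cover (trace c b j)) [set j].

Definition blocks_over (L2 : {set {set {set D0}}}) b : {set {set D0 * D1}} :=
  [set block_of b c | c in L2].

Definition blocks (L1 : {set {set D1}}) (L2 : {set {set {set D0}}})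
    : {set {set D0 * D1}} :=
  \bigcup_(b in L1) blocks_over L2 b.

Definition block_parts (L1 : {set {set D1}}) (L2 : {set {set {set D0}}})
    : {set {set {set D0 * D1}}} :=
  [set blocks_over L2 b | b in L1].

Definition fibres : {set {set D0 * D1}} :=
  [set setX [set: D0] [set i] | i : D1].

Definition aut_imprimitive (B : {set {set D0 * D1}}) : {set {perm D0 * D1}} :=
  (design_aut B :&: 'N(fibres | 'P^*))%g.

Definition wreath_fun (h : D1 -> {perm D0}) (sigma : {perm D1})
    (x : D0 * D1) : D0 * D1 :=
  (h x.2 x.1, sigma x.2).

Lemma wreath_fun_inj h sigma : injective (wreath_fun h sigma).
Proof.
by move=> [x i] [y j] [/= + /perm_inj eij]; rewrite eij => /perm_inj ->.
Qed.

Definition wreath_perm h sigma : {perm D0 * D1} :=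
  perm (@wreath_fun_inj h sigma).

Definition image_blocks (h : {perm D0}) (A : {set {set D0}}) : {set {set D0}} :=
  [set h @: l | l : {set D0} in A].

(* The block (c meet psi_b^-1(j))^(h_j) is taken here as an element. *)
Definition image_trace (h : D1 -> {perm D0}) c b : {set {set D0}} :=
  [set h j @: cover (trace c b j) | j in b & trace c b j != set0].

End Construction.

(* Main.v *)
Require Import Defs.
From mathcomp Require Import all_boot all_fingroup.

(** Fix a point [j] of [D1] and a block [l] of [D0], in the parallel class [P].
    Exactly one [b] satisfies [psi b P = j], so all blocks of [D] meeting the
    fibre of [j] in [l] are of the form [B_b(c)] with [l] in [c]; since any two
    points of [D2] in different groups lie in a common block, the fibres met by
    these blocks are exactly those indexed by [b].  An automorphism preserving
    the fibres respects this characterisation of [b] by [(l, j)]: the block [b]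
    attached to [(l, j)] is sent to the one attached to [(h_j l, sigma j)].
    Hence [sigma @: b] is a block of [D1] and [h_j] maps all of [P] into the
    single class [psi_(sigma b)^-1(sigma j)]. *)

Set Implicit Arguments.
Unset Strict Implicit.
Unset Printing Implicit Defensive.

(** * Slices over the fibres, and fibre-preserving permutations as wreath elements *)

Section Slice.

Variables D0 D1 : finType.
Implicit Types (B : {set D0 * D1}) (h : D1 -> {perm D0}) (sigma : {perm D1}).

(** The slices of [block_of P0 psi b c] are empty or blocks of [D0], hence points of [c]. Comparing
    blocks slice by slice turns equalities between point sets back into statements about [b] and
    [c]. *)
Definition slice B (j : D1) : {set D0} := [set x | (x, j) \in B].

Lemma slice_wreath h sigma B j :
  slice (wreath_perm h sigma @: B) (sigma j) = h j @: slice B j.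
Proof.
apply/setP=> x; rewrite inE; apply/imsetP/imsetP=> [[[y i] yiB]|[y]].
  by rewrite permE => -[-> /perm_inj eji]; exists y; rewrite ?inE eji.
by rewrite inE => yB ->; exists (y, j); rewrite // permE.
Qed.

Lemma imset_perm_neq0 (T : finType) (p : {perm T}) (A : {set T}) :
  (p @: A != set0) = (A != set0).
Proof. by rewrite -!card_gt0 card_imset //; apply: perm_inj. Qed.

(** The point [x0] serves to read off the permutation of the fibres from second coordinates; first
    coordinates then give one permutation of [D0] on each fibre. *)
Lemma fibre_preserving_wreath (B : {set {set D0 * D1}}) (x0 : D0)
    (g : {perm D0 * D1}) :
  g \in aut_imprimitive B -> exists h sigma, g = wreath_perm h sigma.
Proof.
case/setIP=> _ gN.
have fibreP j : exists i, g @: setX [set: D0] [set j] = setX [set: D0] [set i].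
  have : ('P^*)%act (setX [set: D0] [set j]) g \in fibres D0 D1.
    by rewrite (astabs_act _ gN); apply: imset_f.
  by case/imsetP=> i _ e; exists i; rewrite -e.
pose si j := (g (x0, j)).2.
have g_fib x j : (g (x, j)).2 = si j.
  have [i e] := fibreP j.
  have fst_irr y : (g (y, j)).2 = i.
    have : g (y, j) \in setX [set: D0] [set i].
      by rewrite -e imset_f // !inE /=.
    by rewrite !inE => /eqP.
  by rewrite /si !fst_irr.
have si_fib j : g @: setX [set: D0] [set j] = setX [set: D0] [set si j].
  have [i e] := fibreP j; rewrite e; congr (setX _ [set _]).
  have : g (x0, j) \in setX [set: D0] [set i].
    by rewrite -e imset_f // !inE /=.
  by rewrite !inE => /eqP.
(* Two fibres with the same image coincide, since [g] is injective on sets; [x0] witnesses that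
   equal fibres have equal indices. *)
have si_inj : injective si.
  move=> i j e; have := si_fib i; rewrite e -si_fib.
  move/(imset_inj perm_inj)/setP/(_ (x0, i)).
  by rewrite !inE /= eqxx => /esym/eqP.
have h_inj j : injective (fun x => (g (x, j)).1).
  move=> x y e.
  have : g (x, j) = g (y, j).
    by rewrite [g (x, j)]surjective_pairing [g (y, j)]surjective_pairing
               e !g_fib.
  by move/perm_inj=> [].
exists (fun j => perm (@h_inj j)), (perm si_inj); apply/permP=> -[x j].
by rewrite !permE /wreath_fun /= !permE -(g_fib x) -surjective_pairing.
Qed.

End Slice.

(** * Parallel classes and their labels *)

Section Blocks.

Variables (D0 D1 : finType).
Variables (v0 k0 lambda0 r s v1 lambda1 k2 lambda2 : nat).
Variables (L0 : {set {set D0}}) (P0 : {set {set {set D0}}}).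
Variables (L1 : {set {set D1}}) (psi : {set D1} -> {set {set D0}} -> D1).
Variables (L2 : {set {set {set D0}}}).
Hypothesis hD0 : resolvable_design L0 P0 v0 k0 lambda0 r s.
Hypothesis hD1 : symmetric_design L1 v1 r lambda1.
Hypothesis hpsi : bijection_family P0 L1 psi.
Hypothesis hD2 : transversal_design L0 P0 L2 r s k2 lambda2.

Implicit Types (b : {set D1}) (c P Q : {set {set D0}}) (l m : {set D0})
  (j : D1).

Lemma class_block_neq0 l P : P \in P0 -> l \in P -> l != set0.
Proof.
move=> PP0 lP; apply: contraTneq lP => ->.
by have /and3P[] := resolvable_parallel hD0 PP0.
Qed.

Lemma class_in_blocks l P : P \in P0 -> l \in P -> l \in L0.
Proof.
move=> PP0 lP; have /and3P[/eqP <- _ _] := resolvable_partition hD0.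
by apply/bigcupP; exists P.
Qed.

Lemma in_class l : l \in L0 -> exists2 P, P \in P0 & l \in P.
Proof.
by have /and3P[/eqP <- _ _] := resolvable_partition hD0 => /bigcupP.
Qed.

Lemma class_uniq l P Q :
  P \in P0 -> Q \in P0 -> l \in P -> l \in Q -> P = Q.
Proof.
have /and3P[_ tI _] := resolvable_partition hD0.
by move=> PP0 QP0 lP lQ; rewrite -(def_pblock tI PP0 lP) (def_pblock tI QP0 lQ).
Qed.

Lemma class_nonempty P : P \in P0 -> exists l, l \in P.
Proof.
move=> PP0; apply/set0Pn; apply: contraTneq PP0 => ->.
by have /and3P[] := resolvable_partition hD0.
Qed.

Lemma psi_in b P : b \in L1 -> P \in P0 -> psi b P \in b.
Proof.
move=> bL PP0; have /setP/(_ (psi b P)) <- := bijection_im hpsi bL.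
exact: imset_f.
Qed.

Lemma psi_surj b j : b \in L1 -> j \in b -> exists2 P, P \in P0 & j = psi b P.
Proof.
by move=> bL; have /setP/(_ j) <- := bijection_im hpsi bL => /imsetP.
Qed.

Lemma psi_uniq b b' P :
  b \in L1 -> b' \in L1 -> P \in P0 -> psi b P = psi b' P -> b = b'.
Proof.
move=> bL b'L PP0 e; have [b0 [_ u]] := bijection_uniq hpsi (psi b P) PP0.
by rewrite -(u b) // -(u b').
Qed.

Lemma psi_invK b P : b \in L1 -> P \in P0 -> psi_inv P0 psi b (psi b P) = P.
Proof.
move=> bL PP0; rewrite /psi_inv; case: pickP => [Q /andP[QP0 /eqP e]|/(_ P)].
  exact: (bijection_inj hpsi bL).
by rewrite PP0 eqxx.
Qed.

Lemma class_at P j : P \in P0 -> exists2 b, b \in L1 & psi b P = j.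
Proof.
by move=> PP0; have [b [[? ?] _]] := bijection_uniq hpsi j PP0; exists b.
Qed.

Lemma psi_inv_in b j : b \in L1 -> j \in b -> psi_inv P0 psi b j \in P0.
Proof.
by move=> bL jb; have [P PP0 ->] := psi_surj bL jb; rewrite psi_invK.
Qed.

(** * Traces and slices of the constructed blocks *)

Lemma trace_single b c P l : b \in L1 -> c \in L2 -> P \in P0 -> l \in P ->
  l \in c -> trace P0 psi c b (psi b P) = [set l].
Proof.
move=> bL cL PP0 lP lc; rewrite /trace psi_invK //; apply/esym/eqP.
by rewrite eqEcard sub1set inE lc lP cards1 (transversal_meet hD2).
Qed.

Lemma cover_trace b c j l : b \in L1 -> c \in L2 -> j \in b ->
  l \in trace P0 psi c b j -> cover (trace P0 psi c b j) = l.
Proof.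
move=> bL cL jb; have [P PP0 ->] := psi_surj bL jb.
rewrite inE psi_invK // => /andP[lc lP].
by rewrite (trace_single bL cL PP0 lP lc) /cover big_set1.
Qed.

Lemma block_memP b c x j : b \in L1 -> c \in L2 ->
  reflect (exists P l, [/\ P \in P0, l \in P, l \in c, psi b P = j & x \in l])
          ((x, j) \in block_of P0 psi b c).
Proof.
move=> bL cL; apply: (iffP bigcupP) => [[i ib]|[P [l [PP0 lP lc <- xl]]]].
  rewrite !inE /= => /andP[/bigcupP[l /setIP[lc +] xl] /eqP ->].
  have [P PP0 ->] := psi_surj bL ib; rewrite psi_invK // => lP.
  by exists P, l.
exists (psi b P); first exact: psi_in.
by rewrite !inE /= (trace_single bL cL PP0 lP lc) /cover big_set1 xl eqxx.
Qed.

(** By injectivity of [psi b], only [P] has the label [psi b P], and [c] meets [P] in [l] alone. *)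
Lemma slice_block b c P l : b \in L1 -> c \in L2 -> P \in P0 -> l \in P ->
  l \in c -> slice (block_of P0 psi b c) (psi b P) = l.
Proof.
move=> bL cL PP0 lP lc; apply/setP=> x; rewrite inE.
apply/block_memP/idP=> // [[Q [m [QP0 mQ mc e xm]]]|xl]; last by exists P, l.
have eQ : Q = P by apply: (bijection_inj hpsi bL).
suff: m \in [set l] by rewrite inE => /eqP <-.
by rewrite -(trace_single bL cL PP0 lP lc) inE mc psi_invK // -eQ.
Qed.

Lemma slice_block_ex b c j : b \in L1 -> c \in L2 ->
  slice (block_of P0 psi b c) j != set0 ->
  exists P, [/\ P \in P0, psi b P = j, slice (block_of P0 psi b c) j \in P
              & slice (block_of P0 psi b c) j \in c].
Proof.
move=> bL cL /set0Pn[x]; rewrite inE => /block_memP -/(_ bL cL).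
by case=> P [l [PP0 lP lc <- _]]; exists P; rewrite (@slice_block _ _ P l).
Qed.

(** * Joining points of the transversal design *)

Lemma block_in_groups c l :
  c \in L2 -> l \in c -> exists2 P, P \in P0 & l \in P.
Proof.
by move=> cL lc; apply/in_class/(subsetP (transversal_block_sub hD2 cL)).
Qed.

Lemma block_nonempty c : c \in L2 -> exists l, l \in c.
Proof.
move=> cL; apply/set0Pn; rewrite -card_gt0 (transversal_block_card hD2 cL).
exact: ltnW (transversal_k_gt1 hD2).
Qed.

Lemma blocks_join P Q l m : P \in P0 -> Q \in P0 -> P != Q -> l \in P ->
  m \in Q -> exists c, [/\ c \in L2, l \in c & m \in c].
Proof.
move=> PP0 QP0 nPQ lP mQ.
have : 0 < #|[set c in L2 | (l \in c) && (m \in c)]|.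
  rewrite (transversal_pairs hD2 PP0 QP0 nPQ lP mQ).
  exact: transversal_lambda_gt0 hD2.
by case/card_gt0P=> c; rewrite inE => /and3P[]; exists c.
Qed.

(** From [1 < k2] and [k2 <= r]. A second class is what lets [blocks_join] produce blocks through a
    given point. *)
Lemma classes_gt1 : 1 < #|P0|.
Proof.
rewrite (transversal_card hD2).
exact: leq_trans (transversal_k_gt1 hD2) (transversal_k_le hD2).
Qed.

Lemma other_class P : exists2 Q, Q \in P0 & P != Q.
Proof.
have /card_gt0P[Q] : 0 < #|P0 :\ P|.
  have := classes_gt1; rewrite (cardsD1 P); case: (P \in P0) => //.
  exact: ltnW.
by rewrite !inE eq_sym => /andP[nPQ QP0]; exists Q.
Qed.

Lemma block_through P l : P \in P0 -> l \in P -> exists2 c, c \in L2 & l \in c.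
Proof.
move=> PP0 lP; have [Q QP0 nPQ] := other_class P.
have [m mQ] := class_nonempty QP0.
by have [c [cL lc _]] := blocks_join PP0 QP0 nPQ lP mQ; exists c.
Qed.

(** * The partition of the block set *)

(** A point [l] of [c] in the class [P] is the slice at [psi b P]. Equal blocks share this nonempty
    slice, so [l] is in [c'] and [P] has the same label under [b] and [b']; that label determines
    the block of [D1]. *)
Lemma block_of_inj b b' c c' : b \in L1 -> b' \in L1 -> c \in L2 -> c' \in L2 ->
  block_of P0 psi b c = block_of P0 psi b' c' -> b = b' /\ c = c'.
Proof.
have sub b1 b2 c1 c2 l : b1 \in L1 -> b2 \in L1 -> c1 \in L2 -> c2 \in L2 ->
    block_of P0 psi b1 c1 = block_of P0 psi b2 c2 -> l \in c1 ->
    b1 = b2 /\ l \in c2.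
  move=> b1L b2L c1L c2L e lc; have [P PP0 lP] := block_in_groups c1L lc.
  have sl := slice_block b1L c1L PP0 lP lc.
  have := @slice_block_ex b2 c2 (psi b1 P) b2L c2L; rewrite -e sl.
  case=> [|Q [QP0 eQ lQ lc2]]; first exact: class_block_neq0 lP.
  split=> //; rewrite (class_uniq QP0 PP0 lQ lP) in eQ.
  exact: (psi_uniq b1L b2L PP0).
move=> bL b'L cL c'L e; have [l lc] := block_nonempty cL.
have [eb _] := sub _ _ _ _ _ bL b'L cL c'L e lc; split=> //.
apply/setP=> m; apply/idP/idP=> mc.
  by case: (sub _ _ _ _ _ bL b'L cL c'L e mc).
by case: (sub _ _ _ _ _ b'L bL c'L cL (esym e) mc).
Qed.

Lemma blocks_exist : exists c, c \in L2.
Proof.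
have /ltnW/card_gt0P[P PP0] := classes_gt1; have [l lP] := class_nonempty PP0.
by have [c cL _] := block_through PP0 lP; exists c.
Qed.

Lemma block_parts_partition :
  partition (block_parts P0 psi L1 L2) (blocks P0 psi L1 L2).
Proof.
apply/and3P; split.
- apply/eqP/setP=> B; apply/bigcupP/bigcupP=> [[_ /imsetP[b bL ->]]|].
    by exists b.
  by case=> b bL Bb; exists (blocks_over P0 psi L2 b) => //; apply: imset_f.
- apply/trivIsetP=> _ _ /imsetP[b bL ->] /imsetP[b' b'L ->].
  apply: contraR => /pred0Pn[B /andP[/imsetP[c cL eB] /imsetP[c' c'L]]].
  by rewrite eB => /(block_of_inj bL b'L cL c'L)[-> _].
- apply/imsetP=> -[b bL /esym/eqP]; apply/negP/set0Pn.
  by have [c cL] := blocks_exist; exists (block_of P0 psi b c); rewrite imset_f.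
Qed.

(** * The action of a wreath automorphism on classes and blocks *)

Section Automorphism.

Variables (h : D1 -> {perm D0}) (sigma : {perm D1}).
Hypothesis hg : wreath_perm h sigma \in aut_imprimitive (blocks P0 psi L1 L2).

Lemma wreath_block b c : b \in L1 -> c \in L2 ->
  exists b' c', [/\ b' \in L1, c' \in L2 &
    wreath_perm h sigma @: block_of P0 psi b c = block_of P0 psi b' c'].
Proof.
move=> bL cL; have /setIP[gN _] := hg.
have : ('P^*)%act (block_of P0 psi b c) (wreath_perm h sigma)
         \in blocks P0 psi L1 L2.
  by rewrite (astabs_act _ gN); apply/bigcupP; exists b => //; apply: imset_f.
by case/bigcupP=> b' b'L /imsetP[c' c'L e]; exists b', c'; rewrite -e.
Qed.

Lemma wreath_block_slice b c b' c' j : b' \in L1 -> c' \in L2 ->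
  wreath_perm h sigma @: block_of P0 psi b c = block_of P0 psi b' c' ->
  slice (block_of P0 psi b c) j != set0 ->
  exists P', [/\ P' \in P0, psi b' P' = sigma j,
    h j @: slice (block_of P0 psi b c) j \in P'
    & h j @: slice (block_of P0 psi b c) j \in c'].
Proof.
move=> b'L c'L e n0; rewrite -(slice_wreath h sigma) e.
apply: slice_block_ex => //.
by rewrite -e slice_wreath imset_perm_neq0.
Qed.

(** The core of the argument: the image of [l] lies in one class only, and this class with its label
    fixes the block [b'] of [D1] over which every block through [l] at [psi b P] is sent. *)
Lemma image_of_class b P l : b \in L1 -> P \in P0 -> l \in P ->
  sigma @: b \in L1 /\
  exists P', [/\ P' \in P0, psi (sigma @: b) P' = sigma (psi b P)
               & h (psi b P) @: l \in P'].
Proof.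
move=> bL PP0 lP; have nl := class_block_neq0 PP0 lP.
have image_through c : c \in L2 -> l \in c -> exists b' c' P',
    [/\ b' \in L1 /\ c' \in L2,
     wreath_perm h sigma @: block_of P0 psi b c = block_of P0 psi b' c',
     P' \in P0, psi b' P' = sigma (psi b P) & h (psi b P) @: l \in P'].
  move=> cL lc; have [b' [c' [b'L c'L e]]] := wreath_block bL cL.
  have := wreath_block_slice (j := psi b P) b'L c'L e.
  rewrite (slice_block bL cL PP0 lP lc) => /(_ nl)[P' [? ? ? _]].
  by exists b', c', P'.
(* An arbitrary block through [l] gives the candidate [b'] and the class [P']. *)
have [c0 c0L lc0] := block_through PP0 lP.
have [b' [c' [P' [[b'L _] _ P'P0 eP' lP']]]] := image_through _ c0L lc0.
suff eb : sigma @: b = b' by rewrite eb; split=> //; exists P'.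
(* Blocks of [D1] all have [r] points, so one inclusion suffices. *)
apply/eqP; rewrite eqEcard card_imset; last exact: perm_inj.
have card_b := two_design_blocks (symmetric_two_design hD1).
rewrite !card_b // leqnn andbT; apply/subsetP=> _ /imsetP[i ib ->].
have [Q QP0 eQ] := psi_surj bL ib.
have [ePQ|nPQ] := eqVneq P Q; first by rewrite eQ -ePQ -eP' psi_in.
have [m mQ] := class_nonempty QP0.
(* A block [c] through [l] and [m] has nonempty slices at the labels of both [P] and [Q]. The slice
   [l] forces its image to lie over [b']; the slice [m] then puts the image of the label of [Q] in
   [b']. *)
have [c [cL lc mc]] := blocks_join PP0 QP0 nPQ lP mQ.
have [b2 [c2 [P2 [[b2L c2L] e P2P0 eP2 lP2]]]] := image_through _ cL lc.
have eP : P2 = P' := class_uniq P2P0 P'P0 lP2 lP'.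
have <- : b2 = b' by apply: (psi_uniq b2L b'L P'P0); rewrite eP' -eP2 eP.
have := wreath_block_slice (j := psi b Q) b2L c2L e.
rewrite (slice_block bL cL QP0 mQ mc) => /(_ (class_block_neq0 QP0 mQ)).
by case=> Q' [Q'P0 eQ' _ _]; rewrite eQ -eQ' psi_in.
Qed.

Lemma sigma_block b : b \in L1 -> sigma @: b \in L1.
Proof.
move=> bL; have /ltnW/card_gt0P[P PP0] := classes_gt1.
by have [l lP] := class_nonempty PP0; case: (image_of_class bL PP0 lP).
Qed.

(** Blocks of the class land in the class labelled [sigma j], and all classes have [s] elements, so
    the inclusion is an equality. *)
Lemma image_class b j : b \in L1 -> j \in b ->
  image_blocks (h j) (psi_inv P0 psi b j)
  = psi_inv P0 psi (sigma @: b) (sigma j).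
Proof.
move=> bL jb; have [P PP0 ->] := psi_surj bL jb; rewrite psi_invK //.
have sbL := sigma_block bL.
have [P' P'P0 eP'] :
    exists2 P', P' \in P0 & sigma (psi b P) = psi (sigma @: b) P'.
  by apply: psi_surj => //; rewrite imset_f // psi_in.
rewrite eP' psi_invK //; apply/eqP; rewrite eqEcard card_imset; last first.
  exact: imset_inj perm_inj.
rewrite !(resolvable_class_card hD0) // leqnn andbT.
apply/subsetP=> _ /imsetP[l lP ->].
have [_ [P2 [P2P0 eP2 lP2]]] := image_of_class bL PP0 lP.
suff <- : P2 = P' by [].
by apply: (bijection_inj hpsi sbL) => //; rewrite eP2.
Qed.

(** Every class carries the label [j] under some block of [D1], so [image_class] controls [h j] on
    all of [P0]. *)
Lemma image_class_at P j : P \in P0 ->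
  exists2 b, b \in L1 & [/\ psi_inv P0 psi b j = P,
    image_blocks (h j) P = psi_inv P0 psi (sigma @: b) (sigma j)
    & image_blocks (h j) P \in P0].
Proof.
move=> PP0; have [b bL ej] := class_at j PP0; exists b => //.
have jb : j \in b by rewrite -ej psi_in.
have eP : psi_inv P0 psi b j = P by rewrite -ej psi_invK.
rewrite -[in image_blocks _ _]eP (image_class bL jb); split=> //.
by apply: psi_inv_in (sigma_block bL) _; apply: imset_f.
Qed.

Lemma wreath_block_image b c : b \in L1 -> c \in L2 ->
  image_trace P0 psi h c b \in L2 /\
  wreath_perm h sigma @: block_of P0 psi b c
  = block_of P0 psi (sigma @: b) (image_trace P0 psi h c b).
Proof.
move=> bL cL; have [b' [c' [b'L c'L e]]] := wreath_block bL cL.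
(* The image of a single point [l] of [c] identifies [b'], through its class and the label of that
   class. *)
have eb : b' = sigma @: b.
  have [l lc] := block_nonempty cL; have [P PP0 lP] := block_in_groups cL lc.
  have := wreath_block_slice (j := psi b P) b'L c'L e.
  rewrite (slice_block bL cL PP0 lP lc) => /(_ (class_block_neq0 PP0 lP)).
  case=> P1 [P1P0 eP1 lP1 _].
  have [sbL [P2 [P2P0 eP2 lP2]]] := image_of_class bL PP0 lP.
  rewrite (class_uniq P2P0 P1P0 lP2 lP1) in eP2.
  by apply: (psi_uniq b'L sbL P1P0); rewrite eP1 eP2.
suff ec : c' = image_trace P0 psi h c b by rewrite -ec -eb.
apply/setP=> m; apply/idP/imsetP=> [mc|[j]].
  have [Q QP0 mQ] := block_in_groups c'L mc.
  have := slice_block b'L c'L QP0 mQ mc.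
  (* The label of [Q] is pulled back along [sigma] to [j], so that [m] becomes the image under [h j]
     of the slice at [j]. *)
  rewrite -e -[psi b' Q](permKV sigma) slice_wreath.
  set j := (sigma^-1)%g _ => em.
  have := slice_block_ex (j := j) bL cL.
  rewrite -(imset_perm_neq0 (h j)) em => /(_ (class_block_neq0 QP0 mQ)).
  case=> P [PP0 ej lP lc].
  have tr := trace_single bL cL PP0 lP lc; rewrite ej in tr.
  exists j; first by rewrite !inE tr -ej psi_in //= -card_gt0 cards1.
  by rewrite tr /cover big_set1.
rewrite inE => /andP[jb /set0Pn[l]]; have [P PP0 ->] := psi_surj bL jb.
rewrite inE psi_invK // => /andP[lc lP] ->.
have := wreath_block_slice (j := psi b P) b'L c'L e.
rewrite (slice_block bL cL PP0 lP lc) => /(_ (class_block_neq0 PP0 lP)).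
by rewrite (trace_single bL cL PP0 lP lc) /cover big_set1; case=> P' [].
Qed.

Lemma image_trace_class b c j : b \in L1 -> c \in L2 -> j \in b ->
  image_trace P0 psi h c b :&: psi_inv P0 psi (sigma @: b) (sigma j)
  = image_blocks (h j) (trace P0 psi c b j).
Proof.
move=> bL cL jb; apply/setP=> m; apply/setIP/imsetP; last first.
  case=> l lt ->; split; last first.
    by rewrite -image_class //; apply: imset_f; case/setIP: lt.
  apply/imsetP; exists j; last by rewrite (cover_trace (l := l)).
  by rewrite inE jb; apply/set0Pn; exists l.
case=> /imsetP[i]; rewrite inE => /andP[ib /set0Pn[l lt]].
rewrite (cover_trace (l := l)) // => -> lQ.
(* An element of the image trace coming from the index [i] lies in the class labelled [sigma i];
   lying also in the class labelled [sigma j], it forces [i = j]. *)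
suff ij : i = j by exists l; rewrite -?ij.
have lQ' : h i @: l \in psi_inv P0 psi (sigma @: b) (sigma i).
  by rewrite -image_class //; apply: imset_f; case/setIP: lt.
have sbL := sigma_block bL.
have si a : a \in b -> sigma a \in sigma @: b by apply: imset_f.
have [P PP0 eP] := psi_surj sbL (si _ ib).
have [Q QP0 eQ] := psi_surj sbL (si _ jb).
apply: (@perm_inj _ sigma); move: lQ lQ'; rewrite eP eQ !psi_invK //.
by move=> lQ lP; rewrite (class_uniq PP0 QP0 lP lQ).
Qed.

(** * Membership in the automorphism groups and stabilisers *)

Lemma sigma_aut : sigma \in design_aut L1.
Proof.
(* Setwise stabilisers are defined by an inclusion, so mapping blocks to blocks is all that has to
   be checked. *)
rewrite inE in_setT inE; apply/subsetP=> b bL; rewrite inE; exact: sigma_block.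
Qed.

Lemma fibre_perm_aut j : h j \in design_aut L0.
Proof.
rewrite inE in_setT inE; apply/subsetP=> l lL; rewrite inE.
have [P PP0 lP] := in_class lL.
have [b _ [_ _ P'P0]] := image_class_at j PP0.
by apply: class_in_blocks P'P0 _; apply: imset_f.
Qed.

Lemma fibre_perm_aut_star j : h j \in aut_star L0 P0.
Proof.
rewrite inE fibre_perm_aut inE in_setT inE; apply/subsetP=> P PP0; rewrite inE.
by have [b _ [_ _ P'P0]] := image_class_at j PP0.
Qed.

Lemma fibre_perm_aut_classes j : sigma = 1%g -> h j \in aut_classes L0 P0.
Proof.
move=> s1; rewrite inE fibre_perm_aut; apply/astabP=> P PP0.
have [b bL [eP eP' _]] := image_class_at j PP0.
(* With [sigma] trivial, source and target are the class with label [j] under the same [b], so [h j]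
   fixes it. *)
have sb : sigma @: b = b.
  by rewrite s1 -[RHS]imset_id; apply: eq_imset => x; rewrite perm1.
by move: eP'; rewrite sb s1 perm1 eP.
Qed.

Lemma wreath_block_parts :
  wreath_perm h sigma \in 'N(block_parts P0 psi L1 L2 | ('P^*)^*)%g.
Proof.
rewrite inE in_setT inE; apply/subsetP=> _ /imsetP[b bL ->]; rewrite inE.
suff -> : (('P^*)^*)%act (blocks_over P0 psi L2 b) (wreath_perm h sigma)
    = blocks_over P0 psi L2 (sigma @: b).
  by apply: imset_f; apply: sigma_block.
(* By [block_of_inj] every part has as many blocks as [L2], so mapping one part into another is
   mapping it onto. *)
have card_over b1 : b1 \in L1 -> #|blocks_over P0 psi L2 b1| = #|L2|.
  move=> b1L; apply: card_in_imset => c c' cL c'L.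
  by case/(block_of_inj b1L b1L cL c'L).
apply/eqP; rewrite eqEcard card_setact !card_over ?sigma_block // leqnn andbT.
apply/subsetP=> _ /imsetP[_ /imsetP[c cL ->] ->].
have [cL' e] := wreath_block_image bL cL.
by apply/imsetP; exists (image_trace P0 psi h c b).
Qed.

End Automorphism.

(** Any element of the group is a wreath element; the point of [D0] required to decompose it comes
    from a nonempty block of [D0]. *)
Lemma aut_imprimitive_block_parts :
  aut_imprimitive (blocks P0 psi L1 L2)
    \subset 'N(block_parts P0 psi L1 L2 | ('P^*)^*)%g.
Proof.
have /ltnW/card_gt0P[P PP0] := classes_gt1; have [l lP] := class_nonempty PP0.
have /set0Pn[x _] := class_block_neq0 PP0 lP; apply/subsetP=> g gA.
have [h [sigma eg]] := fibre_preserving_wreath x gA; rewrite eg in gA *.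
exact: wreath_block_parts.
Qed.

End Blocks.

Theorem theorem5p1 (D0 D1 : finType)
  (v0 k0 lambda0 r s v1 lambda1 k2 lambda2 : nat)
  (L0 : {set {set D0}}) (P0 : {set {set {set D0}}})
  (hD0 : resolvable_design L0 P0 v0 k0 lambda0 r s)
  (L1 : {set {set D1}})
  (hD1 : symmetric_design L1 v1 r lambda1)
  (psi : {set D1} -> {set {set D0}} -> D1)
  (hpsi : bijection_family P0 L1 psi)
  (L2 : {set {set {set D0}}})
  (hD2 : transversal_design L0 P0 L2 r s k2 lambda2)
  (h : D1 -> {perm D0}) (sigma : {perm D1})
  (hg : wreath_perm h sigma \in aut_imprimitive (blocks P0 psi L1 L2)) :
  (sigma \in design_aut L1 /\ forall j : D1, h j \in aut_star L0 P0)
  /\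
  ((forall (b : {set D1}) (j : D1), b \in L1 -> j \in b ->
      image_blocks (h j) (psi_inv P0 psi b j)
      = psi_inv P0 psi (sigma @: b) (sigma j))
   /\
   (forall (b : {set D1}) (c : {set {set D0}}), b \in L1 -> c \in L2 ->
      image_trace P0 psi h c b \in L2
      /\ forall j : D1, j \in b ->
           image_trace P0 psi h c b :&: psi_inv P0 psi (sigma @: b) (sigma j)
           = image_blocks (h j) (trace P0 psi c b j)))
  /\
  ((forall (b : {set D1}) (c : {set {set D0}}), b \in L1 -> c \in L2 ->
      wreath_perm h sigma @: block_of P0 psi b c
      = block_of P0 psi (sigma @: b) (image_trace P0 psi h c b))
   /\ partition (block_parts P0 psi L1 L2) (blocks P0 psi L1 L2)
   /\ aut_imprimitive (blocks P0 psi L1 L2)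
        \subset ('N(block_parts P0 psi L1 L2 | ('P^*)^*))%g)
  /\
  (sigma = 1%g -> forall j : D1, h j \in aut_classes L0 P0).
Proof.
have image_block := wreath_block_image hD0 hD1 hpsi hD2 hg.
split.
  split=> [|j]; first exact: (sigma_aut hD0 hD1 hpsi hD2 hg).
  exact: (fibre_perm_aut_star hD0 hD1 hpsi hD2 hg j).
split.
  split=> [|b c bL cL]; first exact: (image_class hD0 hD1 hpsi hD2 hg).
  split=> [|j]; first by case: (image_block _ _ bL cL).
  exact: (image_trace_class hD0 hD1 hpsi hD2 hg bL cL).
split; last first.
  by move=> s1 j; apply: (fibre_perm_aut_classes hD0 hD1 hpsi hD2 hg j s1).
split=> [b c bL cL|]; first by case: (image_block _ _ bL cL).
split; first exact: (block_parts_partition hD0 hpsi hD2).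
exact: (aut_imprimitive_block_parts hD0 hD1 hpsi hD2).
Qed.
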